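(* Let $H$ be a real Hilbert space. Let $\alpha>0$, let $A:H\to H$ be an $\alpha$-inverse strongly monotone mapping and let $B:H\to 2^H$ be a maximal monotone mapping such that $A^{-1}0\cap B^{-1}0\neq\emptyset$. Let $r>0$ and let $J_r^B=(I+rB)^{-1}$ be the resolvent of $B$ of order $r$. Let $\{\lambda_n\}_{n\ge 0}\subset[a,b]$ for some $a,b\in(0,2\alpha)$ and $\{\alpha_n\}_{n\ge 0}\subset[c,d]$ for some $c,d\in(0,1)$. For an arbitrary initial value $x_0\in H$, let $\{x_n\}$ be the sequence defined by $$\begin{cases} y_n=\alpha_n x_n+(1-\alpha_n)\,J_r^B(x_n-\lambda_n A x_n),\\ x_{n+1}=J_r^B(y_n-\lambda_n A y_n),\end{cases}\qquad \forall n\ge 0.$$ Then the sequence $\{x_n\}$ converges weakly to a point $p\in A^{-1}0\cap B^{-1}0$, where $p=\lim_{n\to\infty}P_{A^{-1}0\cap B^{-1}0}\,x_n$.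
   Context: $\langle\cdot,\cdot\rangle$ and $\|\cdot\|$ denote the inner product and norm of $H$, and $I$ is the identity mapping. A mapping $A:H\to H$ is $\alpha$-inverse strongly monotone if $\langle Ax-Ay,x-y\rangle\ge\alpha\|Ax-Ay\|^2$ for all $x,y\in H$. A set-valued mapping $B:H\to 2^H$ is monotone if $\langle f-g,u-v\rangle\ge 0$ for all $u,v\in H$, $f\in Bu$, $g\in Bv$; it is maximal monotone if its graph is not properly contained in the graph of any other monotone mapping. $A^{-1}0=\{x\in H:Ax=0\}$ and $B^{-1}0=\{x\in H:0\in Bx\}$. The resolvent $J_r^B:H\to H$, $J_r^Bx=(I+rB)^{-1}x$, is a single-valued mapping on $H$. For a nonempty closed convex set $K\subset H$, $P_K:H\to K$ is the metric projection: $P_Kx$ is the unique point of $K$ with $\|x-P_Kx\|=\inf\{\|x-y\|:y\in K\}$. The limit of the projections is in the norm (strong) topology. *)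

(* Defs.v *)
(* MathComp / MathComp-Analysis.

   A real Hilbert space is a Banach space [H : completeNormedModType R] over
   [R : realType] together with a positive definite symmetric bilinear form
   [ip : {dot H for idfun}] that induces the norm of H ([hilbert_norm ip]). *)
From HB Require Import structures.
From mathcomp Require Import all_boot all_order all_algebra.
From mathcomp Require Import sesquilinear.
From mathcomp Require Import all_classical all_reals all_analysis.

Set Implicit Arguments.
Unset Strict Implicit.
Unset Printing Implicit Defensive.

Import Order.TTheory GRing.Theory Num.Theory.
Import numFieldNormedType.Exports.

Local Open Scope classical_set_scope.
Local Open Scope ring_scope.

Definition hilbert_norm (R : realType) (H : completeNormedModType R)
    (ip : {dot H for idfun}) : Prop :=
  forall x : H, `|x| = Num.sqrt (ip x x).

Definition inverse_strongly_monotone (R : realType)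
    (H : completeNormedModType R) (ip : {dot H for idfun})
    (alpha : R) (A : H -> H) : Prop :=
  forall x y : H, alpha * `|A x - A y| ^+ 2 <= ip (A x - A y) (x - y).

Definition monotone_op (R : realType) (H : completeNormedModType R)
    (ip : {dot H for idfun}) (B : H -> set H) : Prop :=
  forall u v f g : H, B u f -> B v g -> 0 <= ip (f - g) (u - v).

Definition graph_op (H : Type) (B : H -> set H) : set (H * H) :=
  [set z | B z.1 z.2].

Definition maximal_monotone (R : realType) (H : completeNormedModType R)
    (ip : {dot H for idfun}) (B : H -> set H) : Prop :=
  monotone_op ip B /\
  forall C : H -> set H, monotone_op ip C -> ~ (graph_op B `<` graph_op C).

Definition zeros (R : realType) (H : completeNormedModType R)
    (A : H -> H) : set H := [set x | A x = 0].

Definition zeros_op (R : realType) (H : completeNormedModType R)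
    (B : H -> set H) : set H := [set x | B x 0].

Definition id_add_scale (R : realType) (H : completeNormedModType R)
    (r : R) (B : H -> set H) : H -> set H :=
  fun z => [set z + r *: w | w in B z].

(* (I + rB)^-1 x: when B is maximal monotone and r > 0 there is exactly one z
   with x \in z + r B z (Minty); the default value 0 is then never used. *)
Definition resolvent (R : realType) (H : completeNormedModType R)
    (r : R) (B : H -> set H) (x : H) : H :=
  xget 0 [set z | id_add_scale r B z x].

(* For K nonempty, closed and convex there is exactly one such point, so the
   default value 0 is then never used. *)
Definition metric_proj (R : realType) (H : completeNormedModType R)
    (K : set H) (x : H) : H :=
  xget 0 [set p | K p /\ `|x - p| = inf [set `|x - y| | y in K]].

(* Convergence in the weak topology, tested against the topological dual. *)
Definition weakly_converges (R : realType) (H : completeNormedModType R)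
    (u : nat -> H) (p : H) : Prop :=
  forall f : {linear H -> R^o}, continuous f -> (f \o u) @ \oo --> f p.

(* Main.v *)
(* For z in F = A^-1 0 /\ B^-1 0, each forward-backward step decreases the
   squared distance to z by at least a positive multiple of |A x|^2, and the
   averaging defining y_n contributes a further multiple of |x_n - u_n|^2, where
   u_n = J (x_n - lambda_n A x_n). Hence (x_n) is Fejer monotone with respect to
   F, A x_n -> 0 and x_n - u_n -> 0. F is an intersection of closed half-spaces
   given by the monotonicity inequalities, and these pass to weak limits, so
   every weak cluster point of (x_n) is in F. Fejer monotonicity makes the
   projections P_F x_n a Cauchy sequence; its limit q is the only possible weak
   cluster point, by the variational inequality
   <x_n - P_F x_n, p - P_F x_n> <= 0.
   Weak compactness is replaced by limits along ultrafilters and the Riesz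
   theorem. Riesz, the metric projection and Minty's theorem (J is everywhere
   defined) all come from minimizing a strongly convex functional on H x H x R,
   for Minty on the epigraph of the Fitzpatrick function. *)
Require Import Defs.
From HB Require Import structures.
From mathcomp Require Import all_boot all_order all_algebra.
From mathcomp Require Import sesquilinear.
From mathcomp Require Import all_classical all_reals all_analysis.
From mathcomp Require Import ring lra.

Import Order.TTheory GRing.Theory Num.Theory.
Import numFieldNormedType.Exports.

Local Open Scope classical_set_scope.
Local Open Scope ring_scope.

(** * Limits of sequences and along ultrafilters *)

Lemma ge0_of_small (R : realFieldType) (D Q : R) : 0 <= Q ->
  (forall k, 0 < k <= 1 -> 0 <= D + k * Q) -> 0 <= D.
Proof.
move=> Q0 hk; rewrite leNgt; apply/negP => D0.
have QD : 0 < Q - D by lra.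
have := hk (- D / (Q - D)).
rewrite divr_gt0 ?oppr_gt0// ler_pdivrMr// mul1r lerBrDr addNr Q0 => /(_ isT).
have -> : D + - D / (Q - D) * Q = - (D ^+ 2 / (Q - D)) by field; lra.
by rewrite leNgt oppr_lt0 divr_gt0// exprn_even_gt0//= lt_eqF.
Qed.

Lemma cauchy_sqr_dist (R : realType) (H : completeNormedModType R)
    (u : nat -> H) (e : nat -> R) :
  (forall n m, (n <= m)%N -> `|u n - u m| ^+ 2 <= e n) ->
  e @ \oo --> (0 : R) -> cvgn u.
Proof.
move=> ue e0; apply: cauchy_cvg; apply: cauchy_exP => eps eps0.
have /cvgrPdist_lt/(_ (eps ^+ 2) (exprn_gt0 _ eps0)) [N _ HN] := e0.
exists (u N); exists N => // m /= Nm.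
rewrite -ball_normE /= -(@ltr_pXn2r _ 2) ?nnegrE ?normr_ge0 ?(ltW eps0)//.
apply: le_lt_trans (ue _ _ Nm) _.
by have := HN N (leqnn N); rewrite /= sub0r normrN => /ltr_normlW.
Qed.

Lemma cvg0_of_sqr_norm (R : realType) (H : normedModType R)
    (v : nat -> H) (e : nat -> R) (k : R) : 0 < k ->
  (forall n, k * `|v n| ^+ 2 <= e n) -> e @ \oo --> (0 : R) ->
  v @ \oo --> (0 : H).
Proof.
move=> k0 ve e0; apply/cvgr0Pnorm_lt => eps eps0.
have ke : 0 < k * eps ^+ 2 by rewrite mulr_gt0// exprn_gt0.
near=> n; have en : e n < k * eps ^+ 2 by near: n; exact: (cvgr_lt _ e0 _ ke).
rewrite -(@ltr_pXn2r _ 2) ?nnegrE ?normr_ge0 ?(ltW eps0)//.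
by rewrite -(ltr_pM2l k0); exact: le_lt_trans (ve n) en.
Unshelve. all: by end_near. Qed.

(** Compactness of [[- M, M]] gives the image of [U] a cluster point [l]. For each neighborhood [V]
    of [l], [U] contains the preimage of [V] or its complement, and clustering excludes the
    complement. *)
Lemma ultra_bounded_cvg (R : realType) (T : Type) (U : set_system T) (f : T -> R)
    (M : R) :
  UltraFilter U -> (forall t, `|f t| <= M) -> exists l : R, f @ U --> l.
Proof.
move=> UU fM.
have fU : (f @ U) `[- M, M]%classic.
  by apply: (@filterE _ U) => t; rewrite /= in_itv/= -ler_norml.
have [l [_ cl]] := @segment_compact R (- M) M (f @ U) _ fU.
exists l => V Vl.
have [//|UV] := in_ultra_setVsetC (f @^-1` V) UU.
by have [t [nVt Vt]] := cl (~` V) V UV Vl; case: (nVt Vt).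
Qed.

(** Turns limits along ultrafilters back into a limit along [F]. If [V] failed along [F], then [F]
    restricted to the points with values outside [V] would be proper, and an ultrafilter refining it
    would contain both the preimage of [V] and its complement. *)
Lemma cvg_ultra (T : Type) (F : set_system T) (X : topologicalType)
    (f : T -> X) (l : X) : ProperFilter F ->
  (forall U, UltraFilter U -> F `<=` U -> f @ U --> l) -> f @ F --> l.
Proof.
move=> FF fU V Vl; apply: contrapT => nFV.
have GF : ProperFilter (within (~` (f @^-1` V)) F).
  apply: Build_ProperFilter_ex => A FA; apply: contrapT => nA.
  apply: nFV; apply: (@filterS _ F _ _ _ _ FA) => t At.
  by apply: contrapT => nVt; apply: nA; exists t; exact: At.
have [U [UU GU]] := ultraFilterLemma GF.
have UV : U (f @^-1` V).
  apply: (fU U UU _ V Vl) => A FA; apply: GU.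
  by apply: (@filterS _ F _ _ _ _ FA) => t.
have UnV : U (~` (f @^-1` V)) by apply: GU; exact: withinT.
apply: (@filter_not_empty _ U _); rewrite -(setICr (f @^-1` V)).
exact: filterI.
Qed.

(** * Calculus and continuity of the inner product *)

Section Hilbert.
Context (R : realType) (H : completeNormedModType R) (ip : {dot H for idfun})
  (hH : hilbert_norm ip).
Implicit Types x y z h : H.

Lemma ipC x y : ip x y = ip y x.
Proof. by rewrite (hermC ip) expr0 mul1r. Qed.

Lemma ipDl x y z : ip (x + y) z = ip x z + ip y z.
Proof. exact: (linearDl ip). Qed.

Lemma ipNl x z : ip (- x) z = - ip x z.
Proof. exact: (linearNl ip). Qed.

Lemma ipZl (k : R) x z : ip (k *: x) z = k * ip x z.
Proof. exact: (linearZl_LR ip). Qed.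

Lemma ip0l z : ip 0 z = 0.
Proof. exact: (linear0l ip). Qed.

Lemma ipDr x y z : ip z (x + y) = ip z x + ip z y.
Proof. by rewrite ipC ipDl !(ipC _ z). Qed.

Lemma ipNr x z : ip z (- x) = - ip z x.
Proof. by rewrite ipC ipNl ipC. Qed.

Lemma ipZr (k : R) x z : ip z (k *: x) = k * ip z x.
Proof. by rewrite ipC ipZl ipC. Qed.

Lemma ip0r z : ip z 0 = 0.
Proof. by rewrite ipC ip0l. Qed.

Definition ipE := (ipDl, ipDr, ipNl, ipNr, ipZl, ipZr, ip0l, ip0r).

Lemma ip_ge0 x : 0 <= ip x x.
Proof.
have [->|/(@neq0_dnorm_gt0 _ _ _ ip)/ltW //] := eqVneq x 0.
by rewrite ip0l.
Qed.

Lemma ip_eq0 x : ip x x <= 0 -> x = 0.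
Proof.
have [//|/(@neq0_dnorm_gt0 _ _ _ ip) xx0] := eqVneq x 0.
by move/(lt_le_trans xx0); rewrite ltxx.
Qed.

Lemma sqr_normE x : `|x| ^+ 2 = ip x x.
Proof. by rewrite hH sqr_sqrtr ?ip_ge0. Qed.

Lemma cauchy_schwarz x y : `|ip x y| <= `|x| * `|y|.
Proof.
have [y0|yN0] := eqVneq y 0; first by rewrite y0 ip0r normr0 mulr_ge0.
have yy : 0 < ip y y := neq0_dnorm_gt0 y yN0.
rewrite -(@ler_pXn2r _ 2) ?nnegrE ?mulr_ge0 ?normr_ge0//.
rewrite exprMn !sqr_normE real_normK ?num_real//.
(* This vector is [ip y y] times the component of [x] orthogonal to [y]. *)
have := ip_ge0 (ip y y *: x - ip x y *: y).
rewrite !ipE (ipC y x) => hge.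
have : 0 <= ip y y * (ip x x * ip y y - ip x y ^+ 2) by move: hge; lra.
by rewrite pmulr_rge0// subr_ge0.
Qed.

(** By Cauchy-Schwarz. It serves for products in which one factor tends strongly to 0 and the other
    is only bounded, as a weakly convergent family is. *)
Lemma cvg_ip0 (T : Type) (F : set_system T) (FF : Filter F) (u v : T -> H)
    (M : R) : (forall t, `|u t| <= M) -> v @ F --> (0 : H) ->
  ip (u t) (v t) @[t --> F] --> (0 : R).
Proof.
move=> uM v0; apply: norm_cvg0.
apply: (@squeeze_cvgr _ _ _ _ (cst 0) (fun t => M * `|v t|)).
- near=> t; rewrite normr_ge0 /= (le_trans (cauchy_schwarz _ _))//.
  by rewrite ler_wpM2r.
- exact: cvg_cst.
- rewrite -(mulr0 M); apply: cvgM; first exact: cvg_cst.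
  by rewrite -(normr0 H); exact: cvg_norm.
Unshelve. all: by end_near. Qed.

Lemma cvg_ip (T : Type) (F : set_system T) (FF : Filter F) (u v : T -> H)
    (p q : H) : u @ F --> p -> v @ F --> q ->
  ip (u t) (v t) @[t --> F] --> ip p q.
Proof.
move=> up vq.
have /cvg_norm dn0 : (u t - p) @[t --> F] --> (0 : H) by apply/subr_cvg0.
have /cvg_norm qn0 : (v t - q) @[t --> F] --> (0 : H) by apply/subr_cvg0.
apply/subr_cvg0; apply: norm_cvg0.
apply: (@squeeze_cvgr _ _ _ _ (cst 0) (fun t =>
  `|u t - p| * `|v t - q| + `|p| * `|v t - q| + `|q| * `|u t - p|)).
- near=> t; rewrite normr_ge0 /=.
  have -> : ip (u t) (v t) - ip p q
      = ip (u t - p) (v t - q) + ip p (v t - q) + ip q (u t - p).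
    by rewrite !ipE (ipC q (u t)) (ipC q p); ring.
  apply: (le_trans (ler_normD _ _)); rewrite lerD ?cauchy_schwarz//.
  by apply: (le_trans (ler_normD _ _)); rewrite lerD ?cauchy_schwarz.
- exact: cvg_cst.
- rewrite normr0 in dn0 qn0.
  rewrite -[0](_ : 0 * 0 + `|p| * 0 + `|q| * 0 = 0); last by ring.
  by do ?apply: cvgD; apply: cvgM => //; exact: cvg_cst.
Unshelve. all: by end_near. Qed.

(** * Strongly convex minimization, Riesz representation and projections *)

(* Strong convexity makes every minimizing sequence of
   [t + (|x|^2 + |u|^2) / 2] a Cauchy sequence; the conclusion is the
   first-order optimality condition. *)
Lemma quadratic_minimizer (S : H -> H -> R -> Prop) (m0 : R) :
  (exists x u t, S x u t) ->
  (forall x u t y v s k, S x u t -> S y v s -> 0 <= k <= 1 ->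
    S (x + k *: (y - x)) (u + k *: (v - u)) (t + k * (s - t))) ->
  (forall (x_ u_ : nat -> H) (t_ : nat -> R) x u t,
    (forall n, S (x_ n) (u_ n) (t_ n)) ->
    x_ @ \oo --> x -> u_ @ \oo --> u -> t_ @ \oo --> t -> S x u t) ->
  (forall x u t, S x u t -> m0 <= t + (ip x x + ip u u) / 2) ->
  exists x u t, S x u t /\
    forall y v s, S y v s -> t <= s + ip x (y - x) + ip u (v - u).
Proof.
move=> [x1 [u1 [t1 S1]]] Sconv Sclosed Slb.
pose J x u (t : R) := t + (ip x x + ip u u) / 2.
pose E := [set j | exists x u t, S x u t /\ j = J x u t].
have Elb : has_lbound E by exists m0 => _ [x [u [t [/Slb ? ->]]]].
have Einf : has_inf E by split=> //; exists (J x1 u1 t1), x1, u1, t1.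
have mE x u t : S x u t -> inf E <= J x u t.
  by move=> Sxut; apply: ge_inf => //; exists x, u, t.
have /choice[w Hw] n : exists w : H * H * R,
    S w.1.1 w.1.2 w.2 /\ J w.1.1 w.1.2 w.2 < inf E + harmonic n.
  have [_ [x [u [t [Sxut ->]]]] Jlt] := inf_adherent (@harmonic_gt0 R n) Einf.
  by exists (x, u, t).
pose x_ n := (w n).1.1; pose u_ n := (w n).1.2; pose t_ n := (w n).2.
(* At the midpoint, [J] lies below the average of its end values by one eighth of this sum, yet
   stays at least [inf E]. The end values exceed [inf E] by at most [harmonic n]. *)
have dist n m : (n <= m)%N ->
    `|x_ n - x_ m| ^+ 2 + `|u_ n - u_ m| ^+ 2 <= 8 * harmonic n.
  move=> nm; rewrite !sqr_normE.
  have [Sn Jn] := Hw n; have [Sm Jm] := Hw m.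
  have hmn : harmonic m <= harmonic n :> R.
    by rewrite /= lef_pV2 ?posrE// ler_nat.
  have half : 0 <= (2^-1 : R) <= 1 by lra.
  have := mE _ _ _ (Sconv _ _ _ _ _ _ _ Sn Sm half).
  move: Jn Jm; rewrite /J -/(x_ n) -/(x_ m) -/(u_ n) -/(u_ m) -/(t_ n) -/(t_ m).
  rewrite !ipE (ipC (x_ m) (x_ n)) (ipC (u_ m) (u_ n)).
  move: hmn; move: (harmonic m) (harmonic n) => hm hn.
  by lra.
have e0 : 8 * harmonic n @[n --> \oo] --> (0 : R).
  by rewrite -(mulr0 8); apply: cvgM; [exact: cvg_cst|exact: cvg_harmonic].
have /cvg_ex[/= x xx] : cvgn x_.
  apply: (@cauchy_sqr_dist _ _ _ (fun n => 8 * harmonic n)) e0 => n m /dist.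
  by apply: le_trans; rewrite lerDl sqr_ge0.
have /cvg_ex[/= u uu] : cvgn u_.
  apply: (@cauchy_sqr_dist _ _ _ (fun n => 8 * harmonic n)) e0 => n m /dist.
  by apply: le_trans; rewrite lerDr sqr_ge0.
pose q := (ip x x + ip u u) / 2.
have JE : J (x_ n) (u_ n) (t_ n) @[n --> \oo] --> inf E.
  apply: (@squeeze_cvgr _ _ _ _ (cst (inf E)) (fun n => inf E + harmonic n)).
  - near=> n; have [Sn /ltW Jn] := Hw n.
    by rewrite mE.
  - exact: cvg_cst.
  - rewrite -[X in _ --> X]addr0.
    by apply: cvgD; [exact: cvg_cst|exact: cvg_harmonic].
(* The last coordinate converges because both [J] and its quadratic part do. *)
have tt : t_ @ \oo --> inf E - q.
  have -> : t_ = (fun n => J (x_ n) (u_ n) (t_ n)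
                      - (ip (x_ n) (x_ n) + ip (u_ n) (u_ n)) / 2).
    by apply/funext => n; rewrite /J addrK.
  apply: cvgB => //; apply: cvgM; last exact: cvg_cst.
  by apply: cvgD; exact: cvg_ip.
have Sx : S x u (inf E - q).
  by apply: (Sclosed x_ u_ t_) => // n; have [] := Hw n.
exists x, u, (inf E - q); split=> // y v s Sy.
rewrite -subr_ge0.
(* Moving from the minimizer toward [(y, v, s)] with parameter [k] changes [J] by
   [k * D + k ^ 2 * Q], where [D] is the goal and [Q] this term. Divide by [k] and let it tend to
   0. *)
apply: (@ge0_of_small _ _ ((ip (y - x) (y - x) + ip (v - u) (v - u)) / 2)).
  by rewrite divr_ge0// addr_ge0// ip_ge0.
move=> k /andP[k0 k1].
have k01 : 0 <= k <= 1 by rewrite ltW.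
have := mE _ _ _ (Sconv _ _ _ _ _ _ _ Sx Sy k01).
rewrite -(pmulr_rge0 _ k0) /J /q !ipE.
rewrite (ipC y x) (ipC v u).
by lra.
Unshelve. all: by end_near. Qed.

(** The representing vector minimizes |x|^2 / 2 - f x. For this, [S] is the graph of [- f] with the
    second vector frozen at 0, and the bound on [f] gives the lower bound - k^2 / 2. *)
Lemma riesz_representation (f : H -> R) (k : R) :
  (forall x y, f (x + y) = f x + f y) -> (forall c x, f (c *: x) = c * f x) ->
  (forall x, `|f x| <= k * `|x|) -> exists p, forall x, f x = ip p x.
Proof.
move=> fD fZ fk.
have fN x : f (- x) = - f x by rewrite -scaleN1r fZ mulN1r.
have f0 : f 0 = 0 by rewrite -(scale0r 0) fZ mul0r.
have fB x y : f (x - y) = f x - f y by rewrite fD fN.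
pose S (x u : H) (t : R) := u = 0 /\ t = - f x.
have [||||x [u [t [[-> ->] xmin]]]] := @quadratic_minimizer S (- (k ^+ 2 / 2)).
- by exists 0, 0, 0; rewrite /S f0 oppr0.
- move=> x _ _ y _ _ c [-> ->] [-> ->] _.
  by rewrite /S subrr scaler0 addr0 fD fZ fB; split=> //; ring.
- move=> x_ u_ t_ x u t Sn xx uu tt.
  have fx : f (x_ n) @[n --> \oo] --> f x.
    apply/subr_cvg0; apply: norm_cvg0.
    apply: (@squeeze_cvgr _ _ _ _ (cst 0) (fun n => k * `|x_ n - x|)).
    + by near=> n; rewrite normr_ge0 -fB fk.
    + exact: cvg_cst.
    + rewrite -(mulr0 k); apply: cvgM; first exact: cvg_cst.
      by rewrite -(normr0 H); apply: cvg_norm; apply/subr_cvg0.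
  split.
  + apply: (cvg_unique (@norm_hausdorff _ _) uu).
    by rewrite (_ : u_ = cst 0); [exact: cvg_cst|apply/funext=> n; case: (Sn n)].
  + apply: (cvg_unique (@norm_hausdorff _ _) tt).
    rewrite (_ : t_ = (fun n => - f (x_ n))); first exact: cvgN.
    by apply/funext=> n; case: (Sn n).
- move=> x _ _ [-> ->]; rewrite ip0l -sqr_normE.
  have := fk x; have := ler_norm (f x); have := sqr_ge0 (`|x| - k).
  by rewrite sqrrB; lra.
exists x => z.
have Sf y : S y 0 (- f y) by [].
(* Opposite directions turn the optimality inequality into an equality. *)
have := xmin _ _ _ (Sf (x + z)); have := xmin _ _ _ (Sf (x - z)).
rewrite fB fD !ipE => h1 h2.
by apply/eqP; rewrite eq_le; apply/andP; split; lra.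
Unshelve. all: by end_near. Qed.

(** Up to the constant |w|^2 / 2, half the squared distance to [w] is |x|^2 / 2 - <w, x>. The
    optimality condition of its minimizer over [K] is the variational inequality. *)
Lemma projection_exists (K : set H) (w : H) :
  K !=set0 -> closed K ->
  (forall x y k, K x -> K y -> 0 <= k <= 1 -> K (x + k *: (y - x))) ->
  exists2 p, K p & forall y, K y -> ip (w - p) (y - p) <= 0.
Proof.
move=> [x0 Kx0] Kclosed Kconv.
pose S (x u : H) (t : R) := [/\ K x, u = 0 & t = - ip w x].
have [||||p [u [t [[Kp -> ->] pmin]]]] := @quadratic_minimizer S (- (ip w w / 2)).
- by exists x0, 0, (- ip w x0).
- move=> x _ _ y _ _ c [Kx -> ->] [Ky -> ->] c01.
  rewrite /S subrr scaler0 addr0; split=> //; first exact: Kconv.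
  by rewrite !ipE; ring.
- move=> x_ u_ t_ x u t Sn xx uu tt; split.
  + apply: (closed_cvg K Kclosed _ _ xx).
    by near=> n; case: (Sn n).
  + apply: (cvg_unique (@norm_hausdorff _ _) uu).
    by rewrite (_ : u_ = cst 0); [exact: cvg_cst|apply/funext=> n; case: (Sn n)].
  + apply: (cvg_unique (@norm_hausdorff _ _) tt).
    rewrite (_ : t_ = (fun n => - ip w (x_ n))).
      by apply: cvgN; apply: cvg_ip => //; exact: cvg_cst.
    by apply/funext=> n; case: (Sn n).
- move=> x _ _ [_ -> ->]; rewrite ip0l.
  by have := ip_ge0 (w - x); rewrite !ipE (ipC x w); lra.
exists p => // y Ky.
have Sy : S y 0 (- ip w y) by [].
by have := pmin _ _ _ Sy; rewrite !ipE; lra.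
Unshelve. all: by end_near. Qed.

(** * Minty's theorem and the resolvent *)

(* [S] is the epigraph of the Fitzpatrick function of [G], whose value at
   [(x, u)] is at least [ip x u] when [G] is maximal; optimality at the minimizer
   [(x, u)] puts [(- u, - x)] in monotone relation with all of [G]. *)
Lemma minty_surjective (G : H -> set H) : monotone_op ip G ->
  (forall x u, (forall y v, G y v -> 0 <= ip (u - v) (x - y)) -> G x u) ->
  exists z, G z (- z).
Proof.
move=> Gmono Gmax.
pose S (x u : H) (t : R) := forall y v, G y v -> ip x v + ip y u - ip y v <= t.
have SG y v : G y v -> S y v (ip y v).
  move=> Gyv z w Gzw; have := Gmono _ _ _ _ Gyv Gzw.
  by rewrite !ipE (ipC v y) (ipC w y) (ipC v z) (ipC w z); lra.
(* If [t < ip x u], membership in [S] makes [(x, u)] monotonically related to [G], so [G x u] by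
   maximality. Testing [S] at [(x, u)] itself then gives [ip x u <= t]. *)
have S_ge x u t : S x u t -> ip x u <= t.
  move=> Sxut; rewrite leNgt; apply/negP => tlt.
  have : G x u.
    apply: Gmax => y v /Sxut.
    by rewrite !ipE (ipC u x) (ipC v x) (ipC u y) (ipC v y); lra.
  by move=> /Sxut; lra.
have [||||x [u [t [Sxut xumin]]]] := @quadratic_minimizer S 0.
- have [[[y v] Gyv]|G0] := pselect (exists z : H * H, G z.1 z.2).
    by exists y, v, (ip y v); exact: SG.
  by exists 0, 0, 0 => y v Gyv; exfalso; apply: G0; exists (y, v).
- move=> x u t y v s k Sx Sy /andP[k0 k1] z w Gzw.
  have h1 : 0 <= (1 - k) * (t - (ip x w + ip z u - ip z w)).
    by rewrite mulr_ge0 ?subr_ge0// Sx.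
  have h2 : 0 <= k * (s - (ip y w + ip z v - ip z w)).
    by rewrite mulr_ge0 ?subr_ge0// Sy.
  by move: h1 h2; rewrite !ipE; lra.
- move=> x_ u_ t_ x u t Sn xx uu tt y v Gyv.
  apply: (@ler_cvg_to _ \oo _ R
    (fun n => ip (x_ n) v + ip y (u_ n) - ip y v) t_ _ _ _ tt).
    apply: cvgB; last exact: cvg_cst.
    by apply: cvgD; apply: cvg_ip => //; exact: cvg_cst.
  by near=> n; exact: Sn.
- move=> x u t /S_ge xut; have := ip_ge0 (x + u).
  by rewrite !ipE (ipC u x); lra.
(* Optimality is tested at the epigraph point [(y, v, ip y v)], and [t] is bounded below by
   [ip x u]. *)
have xu y v : G y v -> ip (x + u) (x + u) <= ip (- x - v) (- u - y).
  move=> /SG /xumin; have := S_ge _ _ _ Sxut.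
  by rewrite !ipE (ipC u x) (ipC v y) (ipC v u); lra.
have Gux : G (- u) (- x).
  apply: Gmax => y v /xu; apply: le_trans; exact: ip_ge0.
(* At the pair [(- u, - x)] the right-hand side vanishes, so x + u = 0. *)
have := xu _ _ Gux; rewrite subrr ip0l => /ip_eq0/eqP.
rewrite addr_eq0 => /eqP xNu.
by exists x; rewrite {1}xNu.
Unshelve. all: by end_near. Qed.

(** Adjoining the pair [(x, u)] to the graph of [B] keeps it monotone, so by maximality the pair was
    already there. *)
Lemma maximal_monotone_mem (B : H -> set H) x u : maximal_monotone ip B ->
  (forall y v, B y v -> 0 <= ip (u - v) (x - y)) -> B x u.
Proof.
move=> [Bmono Bmax] xu; apply: contrapT => nBxu.
pose C y := [set v | B y v \/ (y = x /\ v = u)].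
apply: (Bmax C).
- move=> y z v w [Byv|[-> ->]] [Bzw|[-> ->]].
  + exact: Bmono.
  + by have := xu _ _ Byv; rewrite !ipE; lra.
  + exact: xu.
  + by rewrite subrr ip0l.
- split; first by move=> [y v] /= Byv; left.
  by move=> /(_ (x, u)) /= CB; apply/nBxu/CB; right.
Qed.

(** Minty's theorem is applied to [G], which is y |-> r B y - x: a [z] with - z in G z satisfies x
    in z + r B z. Hence [xget] returns a true solution, not the default 0. *)
Lemma resolventP (B : H -> set H) (r : R) x : maximal_monotone ip B -> 0 < r ->
  B (resolvent r B x) (r^-1 *: (x - resolvent r B x)).
Proof.
move=> Bmax r0; have rN0 : r != 0 by rewrite gt_eqF.
pose G y := [set v | B y (r^-1 *: (v + x))].
have [||z Gz] := @minty_surjective G.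
- move=> y z v w Gv Gw; have := Bmax.1 _ _ _ _ Gv Gw.
  rewrite -scalerBr ipZl pmulr_rge0 ?invr_gt0//.
  by rewrite opprD addrACA subrr addr0.
- move=> y v yv; apply: (maximal_monotone_mem _ _ _ Bmax) => z w Bzw.
  have := yv z (r *: w - x); rewrite /G /= subrK scalerA mulVf// scale1r.
  move=> /(_ Bzw) h; rewrite -(pmulr_rge0 _ r0) -ipZl.
  by rewrite scalerBr scalerA mulfV// scale1r; move: h; rewrite opprB addrA.
rewrite /resolvent; case: xgetP => [y _ [w Byw <-]|/(_ z)].
  by rewrite addrC addKr scalerA mulVf// scale1r.
case; exists (r^-1 *: (- z + x)) => //.
by rewrite scalerA mulfV// scale1r addrA subrr add0r.
Qed.

(** * Metric projections, weak limits and Fejer monotone sequences *)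

(** The inequality [pyth], a consequence of the variational inequality at [p], shows both that [p]
    attains the infimum and that no other point of [K] does, so [xget] selects [p]. *)
Lemma metric_projP (K : set H) (w : H) :
  K !=set0 -> closed K ->
  (forall x y k, K x -> K y -> 0 <= k <= 1 -> K (x + k *: (y - x))) ->
  K (metric_proj K w) /\
  forall y, K y -> ip (w - metric_proj K w) (y - metric_proj K w) <= 0.
Proof.
move=> K0 Kclosed Kconv.
have [p Kp pP] := projection_exists _ w K0 Kclosed Kconv.
have pyth y : K y -> `|w - p| ^+ 2 + `|p - y| ^+ 2 <= `|w - y| ^+ 2.
  move=> /pP; rewrite !sqr_normE !ipE.
  by rewrite !(ipC y w) !(ipC p w) !(ipC y p); lra.
have pinf : `|w - p| = inf [set `|w - y| | y in K].
  apply/eqP; rewrite eq_le; apply/andP; split.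
    apply: lb_le_inf; first by exists `|w - p|, p.
    move=> _ [y /pyth yle <-]; rewrite -(@ler_pXn2r _ 2) ?nnegrE//.
    by apply: le_trans yle; rewrite lerDl sqr_ge0.
  apply: ge_inf; last by exists p.
  by exists 0 => _ [y _ <-].
suff -> : metric_proj K w = p by [].
rewrite /metric_proj; case: xgetP => [q _ [Kq qinf]|/(_ p)]; last by case.
have := pyth _ Kq; rewrite qinf -pinf gerDl sqr_normE => /ip_eq0/eqP.
by rewrite subr_eq0 => /eqP.
Qed.

(** For each [h] the bounded numbers [ip (x t) h] have a limit along [U]. This limit is linear in
    [h] and at most [M * |h|] in absolute value, so Riesz represents it by a vector [p]. *)
Lemma ultra_weak_cvg (T : Type) (U : set_system T) (x : T -> H) (M : R) :
  UltraFilter U -> (forall t, `|x t| <= M) ->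
  exists p, forall h, ip (x t) h @[t --> U] --> ip p h.
Proof.
move=> UU xM.
have ipM h t : `|ip (x t) h| <= M * `|h|.
  by apply: le_trans (cauchy_schwarz _ _) _; rewrite ler_wpM2r.
have /choice[l xl] h := @ultra_bounded_cvg _ _ U _ _ UU (ipM h).
have uniq (f : T -> R) (a b : R) : f @ U --> a -> f @ U --> b -> a = b.
  by move=> fa; apply: (cvg_unique (@norm_hausdorff _ _) fa).
have [h k|c h|h|p lp] := @riesz_representation l M.
- apply: uniq (xl _) _.
  under eq_fun do rewrite ipDr.
  exact: cvgD.
- apply: uniq (xl _) _.
  under eq_fun do rewrite ipZr.
  by apply: cvgM => //; exact: cvg_cst.
- apply: (closed_cvg [set y : R | y <= M * `|h|] (@closed_le _ _) _ _
    (cvg_norm (xl h))).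
  by near=> t; exact: ipM.
by exists p => h; rewrite -lp.
Unshelve. all: by end_near. Qed.

Lemma continuous_linear_ip (f : {linear H -> R^o}) : continuous f ->
  exists h, forall x, f x = ip h x.
Proof.
move=> /linear_bounded_continuous/linear_boundedP fb.
have [k fk] : exists k, forall x, `|f x| <= k * `|x|.
  by have [k [_ /(_ (k + 1))]] := fb; rewrite ltrDl ltr01; exists (k + 1); auto.
apply: (riesz_representation f k) => // [x y|c x]; first exact: linearD.
exact: linearZ.
Qed.

Lemma fejer_weak_cvg (K : set H) (x : nat -> H) :
  K !=set0 -> closed K ->
  (forall x y k, K x -> K y -> 0 <= k <= 1 -> K (x + k *: (y - x))) ->
  (forall z n, K z -> `|x n.+1 - z| <= `|x n - z|) ->
  (forall U, UltraFilter U -> \oo `<=` U -> forall p,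
    (forall h, ip (x n) h @[n --> U] --> ip p h) -> K p) ->
  exists p, [/\ K p, weakly_converges x p &
    (fun n => metric_proj K (x n)) @ \oo --> p].
Proof.
move=> K0 Kclosed Kconv fejer1 demi.
pose P n := metric_proj K (x n).
have KP n : K (P n) by have [] := metric_projP K (x n) K0 Kclosed Kconv.
have PP n y : K y -> ip (x n - P n) (y - P n) <= 0.
  by have [_] := metric_projP K (x n) K0 Kclosed Kconv; exact.
have pyth n y : K y -> `|x n - P n| ^+ 2 + `|P n - y| ^+ 2 <= `|x n - y| ^+ 2.
  move=> /(PP n); rewrite !sqr_normE !ipE.
  by rewrite !(ipC y (x n)) !(ipC (P n) (x n)) !(ipC y (P n)); lra.
have fejer z n m : K z -> (n <= m)%N -> `|x m - z| <= `|x n - z|.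
  move=> Kz; elim: m => [|m IH]; first by rewrite leqn0 => /eqP ->.
  rewrite leq_eqVlt => /predU1P[->//|/IH]; apply: le_trans; exact: fejer1.
pose d n := `|x n - P n| ^+ 2.
(* Compare the projection of [x m] with the point [P n] of [K], whose distance to [x] has not
   increased since index [n]. *)
have dPn n m : (n <= m)%N -> d m + `|P n - P m| ^+ 2 <= d n.
  move=> nm; rewrite distrC; apply: le_trans (pyth m _ (KP n)) _.
  by rewrite ler_pXn2r ?nnegrE//; exact: fejer.
have dhomo : {homo d : n m / (n <= m)%N >-> m <= n}.
  by move=> n m /dPn; apply: le_trans; rewrite lerDl sqr_ge0.
have dlb : has_lbound (range d) by exists 0 => _ [n _ <-]; exact: sqr_ge0.
have dL := nonincreasing_cvgn dhomo dlb.
have /cvg_ex[/= q Pq] : cvgn P.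
  apply: (@cauchy_sqr_dist _ _ _ (fun n => d n - inf (range d))).
    move=> n m /dPn.
    have : inf (range d) <= d m by apply: ge_inf => //; exists m.
    by lra.
  by apply/subr_cvg0.
have Kq : K q by apply: (closed_cvg K Kclosed _ _ Pq); near=> n; exact: KP.
have [z Kz] := K0.
have xM n : `|x n| <= `|x 0%N - z| + `|z|.
  rewrite -{1}(subrK z (x n)); apply: le_trans (ler_normD _ _) _.
  by rewrite lerD2r; exact: fejer.
(* Any weak limit [p] along [U] lies in [K]. Since [P] tends strongly to [q], the variational
   inequality at [p] becomes |p - q|^2 <= 0 in the limit. *)
have Uq U : UltraFilter U -> \oo `<=` U ->
    forall h, ip (x n) h @[n --> U] --> ip q h.
  move=> UU UF; have [p xp] := ultra_weak_cvg _ _ _ _ UU xM.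
  have Kp := demi _ UU UF _ xp.
  have PU : P @ U --> q by move=> V /Pq /UF.
  suff -> : q = p by [].
  apply/eqP; rewrite eq_sym -subr_eq0; apply/eqP/ip_eq0.
  (* The weakly convergent [x n] is now paired only with the fixed vector [p - q] or with the
     strongly null [P n - q]. *)
  have xPn n : ip (x n - P n) (p - P n)
      = ip (x n) (p - q) - ip (x n) (P n - q) - ip (P n) (p - P n).
    by rewrite !ipE; ring.
  have : ip (x n - P n) (p - P n) @[n --> U] --> ip (p - q) (p - q).
    under eq_fun do rewrite xPn.
    rewrite ipDl ipNl -[ip p (p - q)]subr0.
    apply: cvgB.
      apply: cvgB => //.
      apply: (@cvg_ip0 _ U _ _ _ _ xM).
      exact/subr_cvg0.
    by apply: cvg_ip => //; apply: cvgB => //; exact: cvg_cst.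
  move=> /ler_cvg_to/(_ (cvg_cst 0)); apply.
  by near=> n; exact: PP.
exists q; split=> // f /continuous_linear_ip[h fh].
apply: cvg_ultra => U UU UF.
rewrite fh ipC (_ : f \o x = fun n => ip (x n) h); first exact: Uq.
by apply/funext => n; rewrite /= fh ipC.
Unshelve. all: by end_near. Qed.

(** * The common zeros and the forward-backward step *)

Lemma closed_halfspace w y (k : R) : closed [set p | k <= ip w (y - p)].
Proof.
apply: (@closed_comp _ _ (fun p => ip w (y - p)) [set t : R | k <= t]).
  move=> p _; apply: (@cvg_ip _ (nbhs p) _ (cst w)); first exact: cvg_cst.
  apply: (@cvgB _ _ _ (nbhs p) _ (cst y) id); first exact: cvg_cst.
  exact: cvg_id.
exact: closed_ge.
Qed.

Section Splitting.
Context (alpha : R) (halpha : 0 < alpha) (A : H -> H)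
  (hA : inverse_strongly_monotone ip alpha A)
  (B : H -> set H) (hB : maximal_monotone ip B).
Let K := zeros A `&` zeros_op B.

(** In these inequalities [p] enters affinely, which yields closedness, convexity and stability
    under weak limits. Conversely, taking [y] to be [p] in the first family forces A p = 0, and the
    second puts 0 in B p by maximality. *)
Lemma common_zerosP p : K p <->
  (forall y, alpha * `|A y| ^+ 2 <= ip (A y) (y - p)) /\
  (forall y v, B y v -> 0 <= ip v (y - p)).
Proof.
split=> [[Ap Bp]|[Ap Bp]].
  split=> [y|y v Byv]; first by have := hA y p; rewrite Ap subr0.
  by have := hB.1 _ _ _ _ Byv Bp; rewrite subr0.
split.
  apply: ip_eq0; rewrite -(pmulr_rle0 _ halpha) -sqr_normE.
  by apply: le_trans (Ap p) _; rewrite subrr ip0r.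
apply: maximal_monotone_mem => // y v /Bp.
by rewrite sub0r -(opprB y p) !ipE; lra.
Qed.

Lemma closed_common_zeros : closed K.
Proof.
have -> : K =
    (\bigcap_y [set p | alpha * `|A y| ^+ 2 <= ip (A y) (y - p)]) `&`
    (\bigcap_(yv in [set yv | B yv.1 yv.2]) [set p | 0 <= ip yv.2 (yv.1 - p)]).
  apply/seteqP; split=> p.
    by move=> /common_zerosP[Ap Bp]; split=> [y _|[y v]] /=; auto.
  move=> [Ap Bp]; apply/common_zerosP; split=> [y|y v Byv]; first exact: Ap.
  exact: (Bp (y, v)).
by apply: closedI; apply: closed_bigI => *; exact: closed_halfspace.
Qed.

Lemma convex_common_zeros x y (k : R) : K x -> K y -> 0 <= k <= 1 ->
  K (x + k *: (y - x)).
Proof.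
move=> /common_zerosP[Ax Bx] /common_zerosP[Ay By] /andP[k0 k1].
have mid (c : R) w z : c <= ip w (z - x) -> c <= ip w (z - y) ->
    c <= ip w (z - (x + k *: (y - x))).
  move=> cx cy.
  have h1 : 0 <= (1 - k) * (ip w (z - x) - c) by rewrite mulr_ge0 ?subr_ge0.
  have h2 : 0 <= k * (ip w (z - y) - c) by rewrite mulr_ge0 ?subr_ge0.
  by move: h1 h2; rewrite !ipE; lra.
by apply/common_zerosP; split=> [z|z v Bzv]; apply: mid; auto.
Qed.

(** Inverse strong monotonicity between [y] and [x n], and monotonicity between [(y, v)] and
    [(u n, w n)], pass to the limit: after regrouping, every product pairs a weakly convergent or
    bounded factor with a fixed or strongly null one. *)
Lemma common_zeros_weak_limit (U : set_system nat) (x u w : nat -> H)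
    (M N : R) p :
  UltraFilter U -> (forall n, `|x n| <= M) -> (forall n, `|u n| <= N) ->
  (forall n, B (u n) (w n)) ->
  A \o x @ U --> (0 : H) -> w @ U --> (0 : H) ->
  (fun n => x n - u n) @ U --> (0 : H) ->
  (forall h, ip (x n) h @[n --> U] --> ip p h) -> K p.
Proof.
move=> UU xM uN Buw Ax0 w0 xu0 xp.
have cvg_bnd (f : nat -> H) (C : R) (g : nat -> H) : (forall n, `|f n| <= C) ->
    g @ U --> (0 : H) -> ip (g n) (f n) @[n --> U] --> (0 : R).
  move=> fC g0; under eq_fun do rewrite ipC.
  exact: cvg_ip0 fC g0.
have bndB (f : nat -> H) (C : R) y n : (forall n, `|f n| <= C) ->
    `|f n - y| <= C + `|y|.
  by move=> fC; apply: le_trans (ler_normB _ _) _; rewrite lerD2r.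
apply/common_zerosP; split=> [y|y v Byv].
  have lhs : alpha * ip (A y - A (x n)) (A y - A (x n)) @[n --> U]
      --> alpha * ip (A y) (A y).
    have Ayx : (fun n => A y - A (x n)) @ U --> A y.
      by rewrite -[X in _ --> X]subr0; apply: cvgB => //; exact: cvg_cst.
    by apply: cvgM; [exact: cvg_cst|exact: cvg_ip].
  have rhs : ip (A y - A (x n)) (y - x n) @[n --> U] --> ip (A y) (y - p).
    have -> : (fun n => ip (A y - A (x n)) (y - x n)) = (fun n =>
        (ip (A y) y - ip (x n) (A y)) + ip (A (x n)) (x n - y)).
      by apply/funext => n; rewrite !ipE (ipC (x n) (A y)); ring.
    rewrite -[X in _ --> X]addr0 ipDr ipNr (ipC _ p).
    apply: cvgD; first by apply: cvgB => //; exact: cvg_cst.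
    by apply: cvg_bnd Ax0 => n; exact: bndB.
  rewrite sqr_normE; apply: (ler_cvg_to lhs rhs).
  by near=> n; rewrite -sqr_normE; exact: hA.
have rhs : ip (w n - v) (u n - y) @[n --> U] --> ip v (y - p).
  have -> : (fun n => ip (w n - v) (u n - y)) = (fun n =>
      (ip v y - ip (x n) v) + ip v (x n - u n) + ip (w n) (u n - y)).
    by apply/funext => n; rewrite !ipE (ipC (x n) v); ring.
  rewrite -[X in _ --> X]addr0 -[X in _ --> X + _]addr0 ipDr ipNr (ipC _ p).
  apply: cvgD.
    apply: cvgD; first by apply: cvgB => //; exact: cvg_cst.
    by rewrite -(ip0r v); apply: cvg_ip => //; exact: cvg_cst.
  by apply: cvg_bnd w0 => n; exact: bndB.
apply: (ler_cvg_to (cvg_cst 0) rhs).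
by near=> n; exact: hB.1.
Unshelve. all: by end_near. Qed.

(** With v = x - l A x, the inclusion of (v - u) / r in B u gives <v - u, u - z> >= 0, hence |u - z|
    <= |v - z|. Expanding |v - z|^2 and using l alpha |A x|^2 <= l <A x, x - z> finishes. *)
Lemma forward_backward_le (r l : R) x z : 0 < r -> 0 < l -> K z ->
  `|resolvent r B (x - l *: A x) - z| ^+ 2
    <= `|x - z| ^+ 2 - l * (2 * alpha - l) * `|A x| ^+ 2.
Proof.
move=> r0 l0 /common_zerosP[Az Bz].
set u := resolvent r B _.
have := Bz _ _ (resolventP B r (x - l *: A x) hB r0).
rewrite -/u ipZl pmulr_rge0 ?invr_gt0// => Ju.
have := Az x; rewrite -(ler_pM2l l0) !sqr_normE => Ax.
have := ip_ge0 (x - l *: A x - u).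
move: Ju Ax; rewrite !ipE.
rewrite ?(ipC (A x) x) ?(ipC u x) ?(ipC z x) ?(ipC u (A x)) ?(ipC z (A x)).
by rewrite !(ipC z u); lra.
Qed.

End Splitting.

Lemma sqr_norm_convex_comb (t : R) x u :
  `|t *: x + (1 - t) *: u| ^+ 2
    = t * `|x| ^+ 2 + (1 - t) * `|u| ^+ 2 - t * (1 - t) * `|x - u| ^+ 2.
Proof. by rewrite !sqr_normE !ipE (ipC u x); ring. Qed.

End Hilbert.

(** * Convergence of the two-step scheme *)

Theorem theorem2 (R : realType) (H : completeNormedModType R)
    (ip : {dot H for idfun}) (hH : hilbert_norm ip)
    (alpha : R) (halpha : 0 < alpha)
    (A : H -> H) (hA : inverse_strongly_monotone ip alpha A)
    (B : H -> set H) (hB : maximal_monotone ip B)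
    (hAB : zeros A `&` zeros_op B !=set0)
    (r : R) (hr : 0 < r)
    (a b : R) (ha : 0 < a < 2 * alpha) (hb : 0 < b < 2 * alpha)
    (lambda_ : nat -> R) (hlambda : forall n : nat, a <= lambda_ n <= b)
    (c d : R) (hc : 0 < c < 1) (hd : 0 < d < 1)
    (alpha_ : nat -> R) (halpha_ : forall n : nat, c <= alpha_ n <= d)
    (x0 : H) (x y : nat -> H) (hx0 : x 0%N = x0)
    (hy : forall n : nat, y n = alpha_ n *: x n +
       (1 - alpha_ n) *: resolvent r B (x n - lambda_ n *: A (x n)))
    (hx : forall n : nat, x n.+1 = resolvent r B (y n - lambda_ n *: A (y n))) :
  exists p : H,
    [/\ (zeros A `&` zeros_op B) p,
        weakly_converges x p &
        (fun n : nat => metric_proj (zeros A `&` zeros_op B) (x n)) @ \oo --> p].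
Proof.
set K := zeros A `&` zeros_op B.
pose u n := resolvent r B (x n - lambda_ n *: A (x n)).
have ab := hlambda 0%N; have cd := halpha_ 0%N.
(* Uniform lower bounds of (1 - alpha_n) lambda_n (2 alpha - lambda_n) and of alpha_n (1 - alpha_n),
   the coefficients of the two decrease terms. *)
pose k1 := (1 - d) * (a * (2 * alpha - b)); pose k2 := c * (1 - d).
have k1_gt0 : 0 < k1 by rewrite !mulr_gt0//; lra.
have k2_gt0 : 0 < k2 by rewrite !mulr_gt0//; lra.
have uz z n : K z -> `|u n - z| ^+ 2
    <= `|x n - z| ^+ 2 - lambda_ n * (2 * alpha - lambda_ n) * `|A (x n)| ^+ 2.
  by move=> Kz; have hl := hlambda n; apply: forward_backward_le => //; lra.
have step z n : K z -> `|x n.+1 - z| ^+ 2 + k1 * `|A (x n)| ^+ 2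
    + k2 * `|x n - u n| ^+ 2 <= `|x n - z| ^+ 2.
  move=> Kz; have hl := hlambda n; have ht := halpha_ n.
  have l0 : 0 < lambda_ n by lra.
  (* The decrease in the second resolvent step is dropped; the useful terms come from the convex
     combination defining [y n]. *)
  have xy : `|x n.+1 - z| ^+ 2 <= `|y n - z| ^+ 2.
    rewrite hx; apply: le_trans (forward_backward_le _ _ _ hH _ halpha _ hA _ hB
      _ _ _ _ hr l0 Kz) _.
    by rewrite gerBl mulr_ge0 ?sqr_ge0// mulr_ge0; lra.
  have yE : y n - z = alpha_ n *: (x n - z) + (1 - alpha_ n) *: (u n - z).
    rewrite hy !scalerBr addrACA -opprD -scalerDl (_ : _ + (1 - _) = 1).
      by rewrite scale1r.
    by ring.
  have xu : x n - z - (u n - z) = x n - u n by rewrite opprB addrA subrK.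
  move: xy; rewrite yE (sqr_norm_convex_comb _ _ _ hH) xu => xy.
  have h1 : k1 <= (1 - alpha_ n) * (lambda_ n * (2 * alpha - lambda_ n)).
    apply: ler_pM; try lra.
    - by rewrite mulr_ge0; lra.
    - by apply: ler_pM; lra.
  have h2 : k2 <= alpha_ n * (1 - alpha_ n) by apply: ler_pM; lra.
  have h3 := ler_wpM2r (sqr_ge0 `|A (x n)|) h1.
  have h4 := ler_wpM2r (sqr_ge0 `|x n - u n|) h2.
  have t0 : 0 <= 1 - alpha_ n by lra.
  have h5 := ler_wpM2l t0 (uz _ n Kz).
  by lra.
have fejer1 z n : K z -> `|x n.+1 - z| <= `|x n - z|.
  move=> /(step _ n) h; rewrite -(@ler_pXn2r _ 2) ?nnegrE//.
  apply: le_trans h; rewrite -addrA lerDl.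
  by rewrite addr_ge0// mulr_ge0 ?sqr_ge0// ltW.
have [z Kz] := hAB.
have bnd n : `|x n - z| <= `|x 0%N - z|.
  by elim: n => // n; apply: le_trans; exact: fejer1.
pose D n := `|x n - z| ^+ 2.
(* [D] is nonincreasing and bounded below, so its decrements, which dominate both decrease terms,
   tend to 0. *)
have D0 : D n - D n.+1 @[n --> \oo] --> (0 : R).
  have Dcvg : D @ \oo --> inf (range D).
    apply: nonincreasing_cvgn; last by exists 0 => _ [n _ <-]; exact: sqr_ge0.
    apply/nonincreasing_seqP => n.
    by rewrite ler_pXn2r ?nnegrE//; exact: fejer1.
  by rewrite -(subrr (inf (range D))); apply: cvgB => //; rewrite (cvg_shiftS D).
have Ax0 : A \o x @ \oo --> (0 : H).
  apply: (cvg0_of_sqr_norm _ _ _ _ _ k1_gt0 _ D0) => n /=.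
  have := step z n Kz; have : 0 <= k2 * `|x n - u n| ^+ 2.
    by rewrite mulr_ge0 ?sqr_ge0// ltW.
  by rewrite -/(D n) -/(D n.+1); lra.
have xu0 : (fun n => x n - u n) @ \oo --> (0 : H).
  apply: (cvg0_of_sqr_norm _ _ _ _ _ k2_gt0 _ D0) => n /=.
  have := step z n Kz; have : 0 <= k1 * `|A (x n)| ^+ 2.
    by rewrite mulr_ge0 ?sqr_ge0// ltW.
  by rewrite -/(D n) -/(D n.+1); lra.
(* The element of [B (u n)] supplied by the resolvent. It tends to 0 because [x n - u n] and
   [A (x n)] do and [lambda_] is bounded. *)
pose w n := r^-1 *: (x n - lambda_ n *: A (x n) - u n).
have w0 : w @ \oo --> (0 : H).
  have lA0 : (fun n => lambda_ n *: A (x n)) @ \oo --> (0 : H).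
    apply/norm_cvg0P.
    apply: (@squeeze_cvgr _ _ _ _ (cst 0) (fun n => b * `|A (x n)|)).
    - near=> n; rewrite normr_ge0 normrZ ler_wpM2r//.
      by have hl := hlambda n; rewrite ger0_norm; lra.
    - exact: cvg_cst.
    - rewrite -(mulr0 b); apply: cvgM; first exact: cvg_cst.
      by rewrite -(normr0 H); exact: cvg_norm.
  rewrite -(scaler0 H r^-1) -(subr0 (0 : H)).
  apply: cvgZr; under eq_fun do rewrite addrAC.
  exact: cvgB.
apply: (fejer_weak_cvg _ _ _ hH) => //.
- exact: (closed_common_zeros _ _ _ hH _ halpha _ hA _ hB).
- exact: (convex_common_zeros _ _ _ hH _ halpha _ hA _ hB).
- move=> U UU UF p xp.
  have bnd_norm (f : nat -> H) n : `|f n - z| <= `|x 0%N - z| ->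
      `|f n| <= `|x 0%N - z| + `|z|.
    move=> fz; rewrite -{1}(subrK z (f n)); apply: le_trans (ler_normD _ _) _.
    by rewrite lerD2r.
  have uM n : `|u n - z| <= `|x 0%N - z|.
    apply: le_trans (bnd n); rewrite -(@ler_pXn2r _ 2) ?nnegrE//.
    apply: le_trans (uz _ n Kz) _; have hl := hlambda n.
    by rewrite gerBl mulr_ge0 ?sqr_ge0// mulr_ge0; lra.
  apply: (common_zeros_weak_limit _ _ _ hH _ halpha _ hA _ hB U x u w) xp.
  + by move=> n; exact: bnd_norm.
  + by move=> n; exact: bnd_norm.
  + by move=> n; exact: resolventP.
  + by move=> V /Ax0 /UF.
  + by move=> V /w0 /UF.
  + by move=> V /xu0 /UF.
Unshelve. all: by end_near. Qed.
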